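(* Let $m\ge n\ge 1$ and let $\ell_1,\dots,\ell_m$ be linear forms on $\mathbb{R}^n$ which span a full-dimensional pointed cone $C^*$ in $(\mathbb{R}^n)^*$, such that $\ell_{m-n+1},\dots,\ell_m$ is a basis of $(\mathbb{R}^n)^*$. Use this basis to identify $(\mathbb{R}^n)^*$ with $\mathbb{R}^n$ (with the corresponding Lebesgue measure $dy$), write $y=(y^{(1)},\dots,y^{(n)})$ for the coordinates of a point of $(\mathbb{R}^n)^*$ in this basis, and for $1\le i\le m-n$ let $y_i=(y_{i1},\dots,y_{in})$ be the coordinates of $\ell_i$, so $\ell_i=\sum_{k=1}^n y_{ik}\,\ell_{m-n+k}$. Let $\alpha_1,\dots,\alpha_m$ be positive real numbers and define $\alpha_0$ by $\sum_{i=0}^m\alpha_i=n$. Then the Riesz kernel of $f=\prod_{i=1}^m\ell_i^{-\alpha_i}$ equals $$q(y)=\frac{\Phi(\alpha;\,y,-y_1,\dots,-y_{m-n})}{\prod_{i=1}^m\Gamma(\alpha_i)},$$ where $\Phi(\alpha;y,-y_1,\dots,-y_{m-n})$ is the Aomoto-Gel'fand hypergeometric function of the $(m-n+1)\times(m+1)$ matrix $$\begin{pmatrix}1&0&0&\cdots&0&y\\0&1&0&\cdots&0&-y_1\\0&0&1&\cdots&0&-y_2\\\vdots&\vdots&&\ddots&&\vdots\\0&0&0&\cdots&1&-y_{m-n}\end{pmatrix}$$ whose columns carry, in order, the parameters $\alpha_0,\alpha_1,\dots,\alpha_m$.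
   Context: Riesz kernel: let $C=\{v\in\mathbb{R}^n:\ell_i(v)>0\text{ for }i=1,\dots,m\}$, a nonempty open convex cone with closed dual cone $C^*$ (the cone spanned by $\ell_1,\dots,\ell_m$). The Riesz kernel of $f$ is the nonnegative function $q$ on $C^*$ with $f(x)=\int_{C^*}e^{-\langle y,x\rangle}q(y)\,dy$ for all $x\in C$ (as a density it is determined up to null sets). Aomoto-Gel'fand hypergeometric function: let $N\le M$ and let $A=(a_{ij})$ be an $N\times M$ matrix whose first $N\times N$ submatrix is the identity. Let $\beta_1,\dots,\beta_M$ be complex parameters with $\sum_{j=1}^M\beta_j=M-N$, where $\beta_j$ is attached to column $j$. Then $$\Phi(\beta;a_{ij})=\int_{\mathbb{S}^{N-1}}\prod_{i=1}^N(x_i)_+^{\beta_i-1}\prod_{j=N+1}^M(a_{1j}x_1+\cdots+a_{Nj}x_N)_+^{\beta_j-1}\,dx,$$ where $dx$ is the standard measure on the unit sphere $\mathbb{S}^{N-1}\subset\mathbb{R}^N$ and $(x)_+=\max\{0,x\}$ (the integrand is taken to be $0$ wherever one of the linear forms $x_i$ or $a_{1j}x_1+\cdots+a_{Nj}x_N$ is negative). For parameters where the integral does not converge, $\Phi$ is defined by analytic continuation in the parameters. In the claim, $N=m-n+1$, $M=m+1$, and $(\beta_1,\dots,\beta_M)=(\alpha_0,\dots,\alpha_m)$. *)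

(* Defs.v *)
From HB Require Import structures.
From mathcomp Require Import all_boot all_order all_algebra.
From mathcomp Require Import complex.
From mathcomp Require Import all_classical all_reals all_analysis.
From mathcomp Require Import measurable_realfun.
Set Implicit Arguments.
Unset Strict Implicit.
Unset Printing Implicit Defensive.
Import Order.TTheory GRing.Theory Num.Theory.
Import numFieldNormedType.Exports.
Local Open Scope classical_set_scope.
Local Open Scope ring_scope.
Local Open Scope complex_scope.

(** R^n is represented by [n.-tuple R], with its product sigma-algebra. *)
Section lebesgue_tuple.
Context (R : realType).

Definition tuple_cons n (p : measurableTypeR R * n.-tuple R) : n.+1.-tuple R :=
  [tuple of p.1 :: p.2].

Definition tuple_uncons n (t : n.+1.-tuple R) : measurableTypeR R * n.-tuple R :=
  (thead t, [tuple of behead t]).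

Lemma tuple_consK n : cancel (@tuple_cons n) (@tuple_uncons n).
Proof.
by case=> x t; congr pair; rewrite ?theadE//; apply/val_inj.
Qed.

Lemma tuple_unconsK n : cancel (@tuple_uncons n) (@tuple_cons n).
Proof. by move=> t; rewrite /tuple_cons/= -tuple_eta. Qed.

Lemma measurable_tuple_cons n : measurable_fun setT (@tuple_cons n).
Proof. exact: measurable_cons. Qed.

Lemma measurable_tuple_uncons n : measurable_fun setT (@tuple_uncons n).
Proof.
apply/measurable_fun_pairP; split; last exact: measurable_behead.
rewrite (_ : _ \o _ = @tnth _ _ ^~ ord0)//; exact: measurable_tnth.
Qed.

Section step.
Variables (n : nat) (mu : {sigma_finite_measure set (n.-tuple R) -> \bar R}).

Definition lebesgue_step : set (n.+1.-tuple R) -> \bar R :=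
  pushforward
    (@product_measure1 _ _ (measurableTypeR R) _ R (@lebesgue_measure R) mu) (@tuple_cons n).

Let step0 : lebesgue_step set0 = 0%E.
Proof. by rewrite /lebesgue_step /pushforward preimage_set0 measure0. Qed.

Let step_ge0 A : (0 <= lebesgue_step A)%E.
Proof. by rewrite /lebesgue_step /pushforward measure_ge0. Qed.

Let step_additive : semi_sigma_additive lebesgue_step.
Proof.
move=> F mF tF mUF; rewrite /lebesgue_step /pushforward preimage_bigcup.
have mpre A : measurable A -> measurable (@tuple_cons n @^-1` A).
  by move=> mA; rewrite -[X in measurable X]setTI; exact: measurable_tuple_cons.
apply: measure_semi_sigma_additive.
- by move=> k; exact: mpre.
- apply/trivIsetP => /= i j _ _ ij; rewrite -preimage_setI.
  by move/trivIsetP : tF => /(_ _ _ _ _ ij) ->//; rewrite preimage_set0.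
- by rewrite -preimage_bigcup; exact: mpre.
Qed.

HB.instance Definition _ := isMeasure.Build _ _ _ lebesgue_step
  step0 step_ge0 step_additive.

Let step_sigma_finite : sigma_finite setT lebesgue_step.
Proof.
have /sigma_finiteP[F [TF ndF Foo]] := sigma_finiteT (@lebesgue_measure R).
have /sigma_finiteP[G [TG ndG Goo]] := sigma_finiteT mu.
exists (fun k => @tuple_uncons n @^-1` (F k `*` G k)).
  rewrite -preimage_bigcup (_ : \bigcup_k _ = setT) ?preimage_setT//.
  apply/seteqP; split=> // -[x y] _.
  have [i _ Fix] : (\bigcup_k F k) x by rewrite -TF.
  have [j _ Gjy] : (\bigcup_k G k) y by rewrite -TG.
  exists (maxn i j) => //; split => /=.
  - by move: x Fix; exact/subsetPset/ndF/leq_maxl.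
  - by move: y Gjy; exact/subsetPset/ndG/leq_maxr.
move=> k; have [mF Fk] := Foo k; have [mG Gk] := Goo k; split.
  rewrite -[X in measurable X]setTI; apply: measurable_tuple_uncons => //.
  exact: measurableX.
rewrite /lebesgue_step /pushforward -comp_preimage (_ : _ \o _ = id); last first.
  by apply/funext => p /=; rewrite tuple_consK.
by rewrite preimage_id product_measure1E// lte_mul_pinfty// ge0_fin_numE.
Qed.

HB.instance Definition _ := Measure_isSigmaFinite.Build _ _ _ lebesgue_step
  step_sigma_finite.

End step.

Fixpoint lebesgue_tuple n : {sigma_finite_measure set (n.-tuple R) -> \bar R} :=
  match n with
  | 0 => @dirac _ (0.-tuple R) [tuple] R
  | n'.+1 => lebesgue_step (lebesgue_tuple n')
  end.

End lebesgue_tuple.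

Section sphere.
Context (R : realType) (N : nat).
Implicit Types x : N.-tuple R.

Definition enorm x : R := Num.sqrt (\sum_(i < N) tnth x i ^+ 2).

Definition unit_sphere : set (N.-tuple R) := [set x | enorm x = 1].

Definition radial x : N.-tuple R := [tuple tnth x i / enorm x | i < N].

Definition punctured_ball : set (N.-tuple R) := [set x | 0 < enorm x <= 1].

Lemma measurable_enorm : measurable_fun setT enorm.
Proof.
apply: (@measurableT_comp _ _ _ _ _ _ (@Num.sqrt R) _
  (fun x => \sum_(i < N) tnth x i ^+ 2)).
  apply: continuous_measurable_fun; exact: sqrt_continuous.
apply: measurable_sum => i; apply: measurable_funX; apply: measurable_tnth.
Qed.

Lemma measurable_radial : measurable_fun setT radial.
Proof.
apply/measurable_fun_tnthP => i.
rewrite (_ : _ \o _ = fun x => tnth x i * enorm x `^ (-1)); last first.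
  by apply/funext => x /=; rewrite tnth_mktuple powR_inv1// sqrtr_ge0.
apply: measurable_funM; first exact: measurable_tnth.
apply: (@measurableT_comp _ _ _ _ _ _ (@powR R ^~ (-1)) _ enorm).
  exact: measurable_powR.
exact: measurable_enorm.
Qed.

Lemma measurable_punctured_ball : measurable punctured_ball.
Proof.
rewrite (_ : punctured_ball = enorm @^-1` `]0, 1]).
  by rewrite -[X in measurable X]setTI; exact: measurable_enorm.
by apply/seteqP; split=> x; rewrite /punctured_ball /= in_itv.
Qed.

(** Unnormalized: the mass of E is N times the volume of the cone over E inside
    the unit ball, so that dx = r^(N-1) dr dE in polar coordinates and, for
    N = 1, both points of S^0 have mass 1. *)
Definition sphere_measure (E : set (N.-tuple R)) : \bar R :=
  (N%:R%:E * lebesgue_tuple R N (punctured_ball `&` radial @^-1` E))%E.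

Let sphere0 : sphere_measure set0 = 0%E.
Proof. by rewrite /sphere_measure preimage_set0 setI0 measure0 mule0. Qed.

Let sphere_ge0 E : (0 <= sphere_measure E)%E.
Proof. by rewrite /sphere_measure mule_ge0// lee_fin ler0n. Qed.

Let sphere_additive : semi_sigma_additive sphere_measure.
Proof.
move=> F mF tF mUF; rewrite /sphere_measure.
have mpre A : measurable A ->
    measurable (punctured_ball `&` radial @^-1` A).
  move=> mA; apply: measurableI; first exact: measurable_punctured_ball.
  by rewrite -[X in measurable X]setTI; exact: measurable_radial.
rewrite (_ : (fun k => _) = fun k => (N%:R%:E * \sum_(0 <= i < k)
    lebesgue_tuple R N (punctured_ball `&` radial @^-1` F i))%E); last first.
  by apply/funext => k; rewrite ge0_sume_distrr.
apply: cvgeZl => //; rewrite preimage_bigcup setI_bigcupr.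
apply: measure_semi_sigma_additive.
- by move=> k; exact: mpre.
- apply/trivIsetP => /= i j _ _ ij; rewrite setIACA -preimage_setI.
  by move/trivIsetP : tF => /(_ _ _ _ _ ij) ->//; rewrite preimage_set0 setI0.
- by rewrite -setI_bigcupr -preimage_bigcup; exact: mpre.
Qed.

HB.instance Definition _ := isMeasure.Build _ _ _ sphere_measure
  sphere0 sphere_ge0 sphere_additive.

End sphere.

Section aomoto_gelfand.
Context (R : realType).
Local Notation C := R[i].

(** (t)_+ ^ s with t ^ s = exp (s ln t) for t > 0, and 0 for all t <= 0; the
    choice at t = 0 only affects a null set of the sphere, unless the linear
    form is identically zero. *)
Definition pospow (t : R) (s : C) : C :=
  if 0 < t then
    (t `^ complex.Re s)%:C *
      Complex (cos (complex.Im s * ln t)) (sin (complex.Im s * ln t))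
  else 0.

Variables (N K : nat).
Implicit Types (A : 'M[R]_(N, N + K)) (b : 'rV[C]_(N + K)) (x : N.-tuple R).

Definition AG_integrand A b x : C :=
  (\prod_(i < N) pospow (tnth x i) (b 0 (lshift K i) - 1)) *
  \prod_(j < K)
    pospow (\sum_(i < N) A i (rshift N j) * tnth x i) (b 0 (rshift N j) - 1).

Definition AG_converges A b : Prop :=
  (@sphere_measure R N).-integrable (@unit_sphere R N)
    (fun x => (complex.Re (AG_integrand A b x))%:E) /\
  (@sphere_measure R N).-integrable (@unit_sphere R N)
    (fun x => (complex.Im (AG_integrand A b x))%:E).

Definition AG_integral A b : C :=
  Complex
    (\int[@sphere_measure R N]_(x in @unit_sphere R N)
      complex.Re (AG_integrand A b x))
    (\int[@sphere_measure R N]_(x in @unit_sphere R N)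
      complex.Im (AG_integrand A b x)).

(** With M = N + K, the parameters range over the hyperplane
    b_1 + ... + b_M = M - N = K of C^M. *)
Definition AG_params : set 'rV[C^o]_(N + K) :=
  [set b | \sum_(j < N + K) b 0 j = K%:R].

(** [z] is obtained at [b] by analytic continuation inside the hyperplane: [F]
    is holomorphic on an open set [W] of C^M whose trace on the hyperplane is
    connected and contains [b], and [F] is given by the (convergent) integral
    on some nonempty relatively open subset of that trace. *)
Definition AG_continuation A b (z : C) : Prop :=
  exists (W V : set 'rV[C^o]_(N + K)) (F : 'rV[C^o]_(N + K) -> C^o),
    [/\ open W /\ connected (W `&` AG_params),
        forall w, W w -> differentiable F w,
        open V /\ (V `&` AG_params !=set0),
        forall w, (V `&` AG_params) w ->
          [/\ W w, AG_converges A w & F w = AG_integral A w] &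
        (W `&` AG_params) b /\ F b = z].

(** Only the columns of [A] after its initial identity block enter the
    integrand. At parameters where the integral diverges and no continuation
    exists (poles), the value is the junk 0. *)
Definition AG A b : C :=
  if `[< AG_converges A b >] then AG_integral A b
  else xget 0 [set z | AG_continuation A b z].

End aomoto_gelfand.

Definition Gamma (R : realType) (a : R) : R :=
  \int[@lebesgue_measure R]_(t in `]0, +oo[) (t `^ (a - 1) * expR (- t)).

Section cones.
Context (R : realType) (n m : nat).
Local Notation form := 'Hom('rV[R]_n, R^o).
Variable l : 'I_m -> form.

Definition open_cone : set 'rV[R]_n := [set v | forall i, 0 < l i v].

(** The cone spanned by the [l i], which is the closed dual of [open_cone]. *)
Definition dual_cone : set form :=
  [set y | exists2 c : 'I_m -> R, forall i, 0 <= c i & y = \sum_i c i *: l i].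

Definition pointed_cone (S : set form) : Prop :=
  forall y, S y -> S (- y) -> y = 0.

Definition full_dim_cone (S : set form) : Prop :=
  forall U : {vspace form}, (forall y, S y -> y \in U) -> U = fullv.

(** The dual space is identified with R^n through the basis [B]. *)
Definition of_coords (B : n.-tuple form) (y : n.-tuple R) : form :=
  \sum_(k < n) tnth y k *: tnth B k.

(** [q] is a density on the dual cone in the coordinates of [B]. *)
Definition riesz_kernel (B : n.-tuple form) (f : 'rV[R]_n -> R)
    (q : n.-tuple R -> R) : Prop :=
  let D := of_coords B @^-1` dual_cone in
  [/\ measurable_fun D q,
      forall y, D y -> 0 <= q y &
      forall x, open_cone x ->
        (f x)%:E =
        (\int[lebesgue_tuple R n]_(y in D)
           (expR (- (of_coords B y x)) * q y)%:E)%E].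

End cones.

(* Main.v *)
From HB Require Import structures.
Require Import Defs.
From mathcomp Require Import all_boot all_order all_algebra.
From mathcomp Require Import complex.
From mathcomp Require Import all_classical all_reals all_analysis.
From mathcomp Require Import measurable_realfun ring lra.

(** The kernel comes from a push-forward. For c > 0 one has
    c^(-a) Gamma(a) = int_0^oo t^(a-1) e^(-ct) dt; multiplying these formulas for
    c = l_i(x) shows that f(x) prod_i Gamma(alpha_i) is the integral over the
    orthant of the monomial density prod_i c_i^(alpha_i - 1) times
    exp(-<sum_i c_i l_i, x>). So f is the Laplace transform of the image of that
    density (divided by the Gamma factors) under c |-> sum_i c_i l_i. Using the
    basis to eliminate the last n coefficients, the image has the density

      I(y) = int prod_i t_i^(alpha_i - 1)
                 prod_k (y - sum_i t_i y_i)_k^(alpha_(m-n+k) - 1) dt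

    over the t in the positive orthant of R^(m-n) with y - sum_i t_i y_i > 0
    ([fibre_integral]); [laplace_fibre_integral] is this computation, by Tonelli
    and a translation. Finiteness of the Laplace transform at one point of the
    cone makes I finite almost everywhere.

    On the other side, the condition sum_i alpha_i = n says exactly that the
    Aomoto-Gel'fand integrand is homogeneous of degree -N, N = m - n + 1. For
    such a function supported in x_0 > 0 the integral over the sphere equals the
    integral over the affine chart x_0 = 1 ([integral_sphere_homogeneous]), and
    in that chart the factor x_0^(alpha_0 - 1) is 1 and the others give the
    integrand of I. This holds whatever the sign of alpha_0, so for almost every
    y the integral defining Phi converges absolutely, its value is I(y), and no
    analytic continuation is involved. *)

Set Implicit Arguments.
Unset Strict Implicit.
Unset Printing Implicit Defensive.
Import Order.TTheory GRing.Theory Num.Theory.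
Import numFieldNormedType.Exports.
Local Open Scope classical_set_scope.
Local Open Scope ring_scope.
Local Open Scope complex_scope.

(** * Tonelli and affine substitutions for Lebesgue measure on R^n *)

Section image_measure.
Context d d' (T : measurableType d) (T' : measurableType d') (R : realType).
Variables (m : {measure set T -> \bar R}) (f : T -> T').
Hypothesis mf : measurable_fun setT f.

(** The measurability proof is an argument because it cannot be inferred from
    [f], while the measure structure on [pushforward m f] depends on it. *)
Definition image_measure : {measure set T' -> \bar R} :=
  measure_function_pushforward__canonical__measure_function_Measure m mf.

Lemma ge0_integral_image_measure (g : T' -> \bar R) :
  measurable_fun setT g -> (forall y, (0 <= g y)%E) ->
  (\int[image_measure]_y g y = \int[m]_x g (f x))%E.
Proof.
by move=> mg g0; rewrite ge0_integral_pushforward// preimage_setT.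
Qed.

End image_measure.

Section affine_substitution.
Context (R : realType).
Local Notation mu := (@lebesgue_measure R).

Lemma measurable_affine (a c : R) :
  measurable_fun setT (fun x : measurableTypeR R => a * x + c : measurableTypeR R).
Proof. by apply: measurable_funD => //; apply: measurable_funM. Qed.

(** The image of Lebesgue measure under x |-> a x + c, scaled by a, has the
    length as its value on half-open intervals, hence is Lebesgue measure. *)
Lemma integral_affine (a c : R) (f : measurableTypeR R -> \bar R) : 0 < a ->
  measurable_fun setT f -> (forall x, (0 <= f x)%E) ->
  (\int[mu]_x f (a * x + c)%R = (a^-1)%:E * \int[mu]_x f x)%E.
Proof.
move=> a0 mf f0.
pose phi (x : measurableTypeR R) : measurableTypeR R := a * x + c.
have mphi : measurable_fun setT phi by exact: measurable_affine.
have a0' : 0 <= a by exact: ltW.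
pose nu := mscale (NngNum a0') (image_measure mu mphi).
have muE A : measurable A -> mu A = nu A.
  move=> mA; apply: lebesgue_measure_unique => // X /ocitvP[->|[[u v] /= uv ->]].
    by rewrite !measure0.
  rewrite /nu /mscale /= /pushforward.
  have -> : phi @^-1` `]u, v]%classic = `](u - c) / a, (v - c) / a]%classic.
    apply/seteqP; split => x; rewrite /phi /= !in_itv /=
      ltr_pdivrMr// ler_pdivlMr// ltrBlDr lerBrDr (mulrC x) //.
  rewrite !lebesgue_measure_itv/= !lte_fin uv ltr_pM2r ?invr_gt0// ltrD2r uv.
  by rewrite -!EFinB -EFinM; congr (_%:E); field; rewrite gt_eqF.
rewrite [X in _ = (_ * X)%E](eq_measure_integral nu); last first.
  by move=> A mA _; exact: muE.
rewrite ge0_integral_mscale//= (ge0_integral_image_measure mu mphi)//.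
by rewrite muleA -EFinM mulVf ?gt_eqF// mul1e.
Qed.

Lemma integral_lebesgue_tuple0 (f : 0.-tuple R -> \bar R) :
  measurable_fun setT f -> (\int[lebesgue_tuple R 0]_t f t = f [tuple])%E.
Proof.
by move=> mf; rewrite /= integral_dirac// diracT mul1e.
Qed.

Lemma integral_lebesgue_tupleS n (f : n.+1.-tuple R -> \bar R) :
  measurable_fun setT f -> (forall t, (0 <= f t)%E) ->
  (\int[lebesgue_tuple R n.+1]_t f t =
   \int[mu]_x \int[lebesgue_tuple R n]_t f (tuple_cons (x, t)))%E.
Proof.
move=> mf f0; rewrite /= /lebesgue_step.
rewrite ge0_integral_pushforward//=; last exact: measurable_tuple_cons.
rewrite preimage_setT.
rewrite (fubini_tonelli1 (m2 := lebesgue_tuple R n) (f \o @tuple_cons R n))//=.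
apply: measurableT_comp => //; exact: measurable_tuple_cons.
Qed.

Lemma measurable_tuple_consr n (x : measurableTypeR R) :
  measurable_fun setT (fun t : n.-tuple R => tuple_cons (x, t)).
Proof.
apply: measurableT_comp; first exact: measurable_tuple_cons.
exact: measurable_pair1.
Qed.

Lemma measurable_integral_tail n (f : n.+1.-tuple R -> \bar R) :
  measurable_fun setT f -> (forall t, (0 <= f t)%E) ->
  measurable_fun setT
    (fun x => \int[lebesgue_tuple R n]_t f (tuple_cons (x, t)))%E.
Proof.
move=> mf f0.
apply: (measurable_fun_fubini_tonelli_F (m2 := lebesgue_tuple R n)
  (f \o @tuple_cons R n)) => [|z]; last exact: f0.
by apply: measurableT_comp => //; exact: measurable_tuple_cons.
Qed.

Lemma tnth_cons0 n (x : R) (t : n.-tuple R) : tnth (tuple_cons (x, t)) ord0 = x.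
Proof. by []. Qed.

Lemma tnth_consS n (x : R) (t : n.-tuple R) i :
  tnth (tuple_cons (x, t)) (lift ord0 i) = tnth t i.
Proof. by rewrite /tuple_cons tnthS. Qed.

Definition affine_tuple n (a : R) (c t : n.-tuple R) : n.-tuple R :=
  [tuple a * tnth t i + tnth c i | i < n].

Lemma measurable_affine_tuple n (a : R) (c : n.-tuple R) :
  measurable_fun setT (affine_tuple a c).
Proof.
apply/measurable_fun_tnthP => i.
rewrite (_ : _ \o _ = fun t => a * tnth t i + tnth c i); last first.
  by apply/funext => t /=; rewrite tnth_mktuple.
apply: measurable_funD => //; apply: measurable_funM => //.
exact: measurable_tnth.
Qed.

Lemma affine_tuple_cons n (a x c0 : R) (c t : n.-tuple R) :
  affine_tuple a (tuple_cons (c0, c)) (tuple_cons (x, t)) =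
  tuple_cons (a * x + c0, affine_tuple a c t).
Proof.
apply/eq_from_tnth => i; case: (unliftP ord0 i) => [j|] ->.
  by rewrite tnth_mktuple !tnth_consS tnth_mktuple.
by rewrite tnth_mktuple.
Qed.

(** Translations (a = 1) straighten the fibres in the Laplace transform below;
    dilations (c = 0) carry the slice of a cone at height 1 to other heights. *)
Lemma integral_affine_tuple n (a : R) (c : n.-tuple R)
    (f : n.-tuple R -> \bar R) : 0 < a ->
  measurable_fun setT f -> (forall t, (0 <= f t)%E) ->
  (\int[lebesgue_tuple R n]_t f (affine_tuple a c t) =
   (a ^- n)%:E * \int[lebesgue_tuple R n]_t f t)%E.
Proof.
move=> a0; elim: n c f => [|n IH] c f mf f0.
  rewrite !integral_lebesgue_tuple0 ?expr0 ?invr1 ?mul1e; last 2 first.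
  - by [].
  - by apply: measurableT_comp => //; exact: measurable_affine_tuple.
  by rewrite [affine_tuple _ _ _]tuple0.
rewrite -(tuple_unconsK c); case: (tuple_uncons c) => c0 {}c.
rewrite !integral_lebesgue_tupleS//; last first.
  by apply: measurableT_comp => //; exact: measurable_affine_tuple.
pose G x := (\int[lebesgue_tuple R n]_t f (tuple_cons (x, t)))%E.
have G0 x : (0 <= G x)%E by exact: integral_ge0.
have mG : measurable_fun setT G by exact: measurable_integral_tail.
transitivity (\int[mu]_x ((a ^- n)%:E * G (a * x + c0)%R))%E.
  apply: eq_integral => x _.
  under eq_integral do rewrite affine_tuple_cons.
  rewrite (IH c (fun t => f (tuple_cons (a * x + c0, t))))//.
  by apply: measurableT_comp => //; exact: measurable_tuple_consr.
have mGa : measurable_fun setT (fun x => G (a * x + c0)).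
  exact: (measurableT_comp mG (measurable_affine a c0)).
have an0 : 0 <= a ^- n by rewrite invr_ge0 exprn_ge0 ?ltW.
rewrite (ge0_integralZl_EFin mu measurableT (fun x _ => G0 _) mGa an0).
by rewrite integral_affine// muleA -EFinM exprSr invfM mulrC.
Qed.

Lemma measurable_prod_tnth n (g : 'I_n -> measurableTypeR R -> R) :
  (forall i, measurable_fun setT (g i)) ->
  measurable_fun setT (fun t : n.-tuple R => \prod_i g i (tnth t i)).
Proof.
move=> mg; apply: measurable_prod => i _.
exact: (measurableT_comp (mg i) (measurable_tnth i)).
Qed.

Lemma integral_prod_tnth n (g : 'I_n -> measurableTypeR R -> R) (c : 'I_n -> R) :
  (forall i, measurable_fun setT (g i)) -> (forall i x, 0 <= g i x) ->
  (forall i, \int[mu]_x (g i x)%:E = (c i)%:E)%E ->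
  (\int[lebesgue_tuple R n]_t (\prod_i g i (tnth t i))%:E = (\prod_i c i)%:E)%E.
Proof.
elim: n g c => [|n IH] g c mg g0 gc.
  rewrite integral_lebesgue_tuple0 ?big_ord0//.
  by apply/measurable_EFinP; exact: measurable_prod_tnth.
rewrite integral_lebesgue_tupleS; last 2 first.
- by apply/measurable_EFinP; exact: measurable_prod_tnth.
- by move=> t; rewrite lee_fin; apply: prodr_ge0 => i _.
pose P := \prod_i c (lift ord0 i).
have IHP : (\int[lebesgue_tuple R n]_t
    (\prod_i g (lift ord0 i) (tnth t i))%:E = P%:E)%E.
  exact: (IH (fun i => g (lift ord0 i)) (fun i => c (lift ord0 i))).
have P0 : 0 <= P.
  by rewrite -lee_fin -IHP integral_ge0// => t _; rewrite lee_fin; apply: prodr_ge0 => i _.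
transitivity (\int[mu]_x ((g ord0 x)%:E * P%:E))%E.
  apply: eq_integral => x _; rewrite -IHP -(ge0_integralZl_EFin _ measurableT)//; last 2 first.
  - by move=> t _; rewrite lee_fin; apply: prodr_ge0 => i _.
  - apply/measurable_EFinP.
    exact: (@measurable_prod_tnth _ (fun i => g (lift ord0 i))).
  apply: eq_integral => t _; rewrite -EFinM big_ord_recl tnth_cons0.
  by congr (_ * _)%:E; apply: eq_bigr => i _; rewrite tnth_consS.
rewrite ge0_integralZr ?lee_fin//; last 2 first.
- exact/measurable_EFinP.
- by move=> x _; rewrite lee_fin.
by rewrite gc -EFinM big_ord_recl.
Qed.

End affine_substitution.

(** * One-dimensional integrals *)

Section one_variable.
Context (R : realType).
Local Notation mu := (@lebesgue_measure R).

Lemma integral_is_derive (f F : R -> R) (a b : R) : a < b ->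
  (forall x, a <= x <= b -> is_derive x 1 F (f x)) ->
  (forall x, a <= x <= b -> {for x, continuous f}) ->
  (\int[mu]_(x in `[a, b]) (f x)%:E = (F b - F a)%:E)%E.
Proof.
move=> ab dF cf.
have cF x : a <= x <= b -> {for x, continuous F}.
  by move=> /dF[Fx _]; apply/differentiable_continuous/derivable1_diffP.
rewrite EFinB; apply: continuous_FTC2 => //.
- apply: continuous_in_subspaceT => x; rewrite inE /= in_itv /= => xab.
  exact: cf.
- split.
  + by move=> x; rewrite in_itv/= => /andP[ax xb]; have [] // := dF x; rewrite ?ltW.
  + by apply/cvg_at_right_filter; apply: cF; rewrite lexx ltW.
  + by apply/cvg_at_left_filter; apply: cF; rewrite lexx ltW.
- move=> x; rewrite in_itv/= => /andP[ax xb].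
  have [|Fx Fxf] := dF x; first by rewrite !ltW.
  by rewrite derive1E Fxf.
Qed.

Lemma integral_expr n (r : R) : 0 < r ->
  (\int[mu]_(x in `]0%R, r]) (x ^+ n)%:E = (r ^+ n.+1 / n.+1%:R)%:E)%E.
Proof.
move=> r0; rewrite (@integral_itv_obnd_cbnd R 0 (BRight r) (fun x => (x ^+ n)%:E)); last first.
  by apply/measurable_EFinP; exact: measurable_funX.
have dF (x : R) : is_derive x 1 (fun x => n.+1%:R^-1 * x ^+ n.+1) (x ^+ n).
  have -> : (fun x : R => n.+1%:R^-1 * x ^+ n.+1) = n.+1%:R^-1 \*: (id ^+ n.+1 : R -> R).
    by apply/funext => y; rewrite /= exprfctE.
  apply: is_derive_eq.
  by rewrite /GRing.scale /= mulr1 mulrA mulVf ?mul1r// pnatr_eq0.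
have cf (x : R) : {for x, continuous (fun x : R => x ^+ n)}.
  exact: exprn_continuous.
rewrite (integral_is_derive r0 (fun x _ => dF x) (fun x _ => cf x)).
by rewrite expr0n mulr0 subr0 mulrC.
Qed.

(** The values of [pospow] at real exponents, see [pospow_real]. *)
Definition pospowR (t s : R) : R := if 0 < t then t `^ s else 0.

Lemma pospowR_ge0 t s : 0 <= pospowR t s.
Proof. by rewrite /pospowR; case: ifP => // _; exact: powR_ge0. Qed.

Lemma pospowRE t s : pospowR t s = t `^ s * \1_(`]0, +oo[%classic) t.
Proof.
rewrite /pospowR indicE; case: ifPn => t0.
  by rewrite mem_set ?mulr1//= in_itv/= t0.
by rewrite memNset ?mulr0//= in_itv/= andbT; apply/negP.
Qed.

Lemma measurable_pospowR s : measurable_fun setT (fun t : measurableTypeR R => pospowR t s).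
Proof.
rewrite (_ : (fun t => _) = (fun t => t `^ s * \1_(`]0, +oo[%classic) t)).
  by apply: measurable_funM => //; exact: measurable_powR.
by apply/funext => t; rewrite pospowRE.
Qed.

Lemma pospowRM c t s : 0 < c -> pospowR (c * t) s = c `^ s * pospowR t s.
Proof.
move=> c0; rewrite /pospowR pmulr_rgt0//; case: ifPn => t0; last by rewrite mulr0.
by rewrite powRM// ltW.
Qed.

Lemma measurable_expRN_scale (c : R) :
  measurable_fun setT (fun t : measurableTypeR R => expR (- (c * t))).
Proof.
rewrite (_ : (fun t => _) = expR \o (fun t => (- c) * t + 0)); last first.
  by apply/funext => t /=; rewrite addr0 mulNr.
exact: (measurableT_comp (@measurable_expR R) (measurable_affine (- c) 0)).
Qed.

(** Serves to bound t^(a-1) e^(-t) by K t^(a-1) / (1 + t^a)^2, the derivative of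
    a bounded function. *)
Lemma expR_ge_powR_sqr (a : R) : 0 < a -> exists2 K : R, 0 < K &
  forall t, 0 < t -> (1 + t `^ a) ^+ 2 <= K * expR t.
Proof.
move=> a0; have [n an] : exists n, a <= n%:R.
  by exists (Num.truncn a).+1; rewrite ltW// truncnS_gt.
have n0 : (0 < n)%N by rewrite -(ltr_nat R) (lt_le_trans a0).
exists (8 + 2 * (n + n)`!%:R) => [|t t0].
  by rewrite addr_gt0// mulr_gt0// ltr0n fact_gt0.
have tn0 : 0 <= t ^+ n by rewrite exprn_ge0// ltW.
have tan : t `^ a <= 1 + t ^+ n.
  have [t1|t1] := leP t 1.
    by rewrite (@le_trans _ _ 1)// ?lerDl// -(powRr0 t) ger_powR ?t0// ltW.
  rewrite (@le_trans _ _ (t ^+ n))// ?lerDr//.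
  by rewrite -powR_mulrn ?(ltW t0)// ler_powR// ltW.
have e1 : 1 <= expR t by rewrite -expR0 ler_expR ltW.
have [k nk] : exists k, (n + n = k.+1)%N by exists (n + n).-1; rewrite prednK// addn_gt0 n0.
have e2 : t ^+ n ^+ 2 <= (n + n)`!%:R * expR t.
  have f0 : 0 < (n + n)`!%:R :> R by rewrite ltr0n fact_gt0.
  rewrite -ler_pdivrMl// expr2 -exprD mulrC.
  have := expR_ge1Dxn k (ltW t0); rewrite -nk; apply: le_trans.
  by rewrite lerDr.
have := powR_ge0 t a; move: tan e1 e2 tn0; move: (t `^ a) (t ^+ n) (expR t) => x y e.
move: (_`!%:R) => F xy e1 e2 y0 x0.
have h1 : (1 + x) ^+ 2 <= (2 + y) ^+ 2.
  by rewrite lerXn2r ?nnegrE//; lra.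
have h2 : 0 <= (2 - y) ^+ 2 by exact: sqr_ge0.
by rewrite (le_trans h1)//; rewrite !expr2 in h2 e2 *; lra.
Qed.

(** The primitive -(K/a) / (1 + t^a) of the bound is monotone with total
    variation K/a on ]0, +oo[; it controls the singularity at 0 and the tail at
    infinity together. *)
Lemma gamma_finite (a : R) : 0 < a ->
  (\int[mu]_(t in `]0%R, +oo[) (t `^ (a - 1) * expR (- t))%:E < +oo)%E.
Proof.
move=> a0; have [K K0 HK] := expR_ge_powR_sqr a0.
pose g (t : R) : R := t `^ (a - 1) * expR (- t).
pose G (t : R) : R := - (K / a) * (1 + t `^ a)^-1.
pose G' (t : R) : R := K * (t `^ (a - 1) * ((1 + t `^ a)^-1 * (1 + t `^ a)^-1)).
have p0 (t : R) : 0 < 1 + t `^ a by rewrite ltr_wpDr ?powR_ge0.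
have dG (t : R) : 0 < t -> is_derive t 1 G (G' t).
  move=> t0; have dp := is_derive1_powR a t0.
  have dp1 : is_derive t 1 (fun x => 1 + x `^ a) (a * t `^ (a - 1)).
    have -> : (fun x : R => 1 + x `^ a) = cst 1 + (@powR R ^~ a) by [].
    by apply: is_derive_eq; rewrite add0r.
  have dV := @is_deriveV _ _ t _ 1 (lt0r_neq0 (p0 t)) dp1.
  have dZ := is_deriveZ (- (K / a)) dV.
  apply: (is_derive_eq dZ).
  rewrite /G' /GRing.scale /=; move: (p0 t) (t `^ (a - 1)).
  move: (1 + t `^ a) => q q0 w; field; rewrite !gt_eqF//=.
have cp b (t : R) : 0 < t -> {for t, continuous (@powR R ^~ b)}.
  move=> t0; have [/derivable1_diffP dp _] := is_derive1_powR b t0.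
  exact: differentiable_continuous.
have cG (t : R) : 0 < t -> {for t, continuous G'}.
  move=> t0; apply: cvgM; first exact: cvg_cst.
  apply: cvgM; first exact: cp.
  have cV : (1 + x `^ a)^-1 @[x --> t] --> (1 + t `^ a)^-1.
    apply: cvgV; first exact: lt0r_neq0.
    by apply: cvgD; [exact: cvg_cst|exact: cp].
  exact: cvgM.
have mg : measurable_fun setT g.
  by apply: measurable_funM; [exact: measurable_powR|exact: measurableT_comp].
have g0 t : 0 <= g t by rewrite mulr_ge0 ?powR_ge0 ?expR_ge0.
have gG t : 0 < t -> g t <= G' t.
  move=> t0; rewrite /g /G' mulrCA ler_wpM2l ?powR_ge0//.
  rewrite -invfM -expr2 expRN ler_pdivlMr ?exprn_gt0// ler_pdivrMl ?expR_gt0//.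
  by rewrite mulrC HK.
pose F i : set R := `[i.+1%:R^-1, i.+2%:R]%classic.
have FU : \bigcup_i F i = `]0, +oo[%classic.
  apply/seteqP; split => [t [i _]|t]; rewrite /F /= !in_itv/=.
    by move=> /andP[it _]; rewrite andbT (lt_le_trans _ it).
  rewrite andbT => t0.
  have [i it] : exists i : nat, Num.max t t^-1 <= i%:R.
    by exists (Num.truncn (Num.max t t^-1)).+1; rewrite ltW// truncnS_gt.
  exists i => //=; rewrite in_itv/=; move: it; rewrite ge_max => /andP[ti t1i].
  have i2 : i%:R <= i.+2%:R :> R by rewrite ler_nat -addn2 leq_addr.
  rewrite (le_trans ti)// andbT.
  by rewrite invf_ple ?posrE// (le_trans t1i)// ler_nat.
have ndF : nondecreasing_seq F.
  apply/nondecreasing_seqP => i; apply/subsetPset => t; rewrite /F /= !in_itv/=.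
  move=> /andP[it ti]; rewrite (le_trans _ it) ?(le_trans ti) ?ler_nat//.
  by rewrite lef_pV2 ?posrE// ler_nat.
have cvF := @ge0_nondecreasing_set_cvg_integral _ (measurableTypeR R) R F (EFin \o g) mu ndF.
rewrite -FU; apply: (@le_lt_trans _ _ (K / a)%:E); last by rewrite ltry.
rewrite -(cvg_lim _ (cvF _ _ _))//; last 3 first.
- by move=> i; exact: measurable_itv.
- by move=> i; apply: measurable_funTS; exact/measurable_EFinP.
- by move=> i t _; rewrite lee_fin.
apply: lime_le.
  apply: ereal_nondecreasing_is_cvgn.
  apply: ge0_nondecreasing_set_nondecreasing_integral => //.
  - by move=> i; exact: measurable_itv.
  - by move=> i; apply: measurable_funTS; exact/measurable_EFinP.
  - by move=> i t _; rewrite lee_fin.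
apply: nearW => i.
have i0 (t : R) : i.+1%:R^-1 <= t <= i.+2%:R -> 0 < t.
  by move=> /andP[it _]; rewrite (lt_le_trans _ it).
have i12 : i.+1%:R^-1 < i.+2%:R :> R.
  by rewrite (@le_lt_trans _ _ 1) ?ltr1n// invf_le1 ?ler1n.
apply: (@le_trans _ _ (\int[mu]_(x in F i) (G' x)%:E)%E).
  apply: ge0_le_integral.
  - exact: measurable_itv.
  - by move=> t _; rewrite lee_fin.
  - by apply: measurable_funTS; exact/measurable_EFinP.
  - have cw : {within F i, continuous G'}.
      apply: continuous_in_subspaceT => t; rewrite inE /F /= in_itv /= => /i0.
      exact: cG.
    have mF : measurable (F i : set R) by exact: measurable_itv.
    by apply/measurable_EFinP; exact: (subspace_continuous_measurable_fun mF cw).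
  - by move=> t; rewrite /F /= in_itv /= => /i0 /gG; rewrite lee_fin.
rewrite (integral_is_derive i12 (fun x h => dG x (i0 x h)) (fun x h => cG x (i0 x h))).
have Ka : 0 <= K / a by rewrite divr_ge0 ?ltW.
have h1 : 0 <= K / a * (1 + i.+2%:R `^ a)^-1 by rewrite mulr_ge0// invr_ge0 ltW.
have h2 : K / a * (1 + i.+1%:R^-1 `^ a)^-1 <= K / a.
  by rewrite ler_piMr// invf_le1// lerDl powR_ge0.
rewrite lee_fin /G !mulNr opprK.
move: (K / a / (1 + i.+2%:R `^ a)) (K / a / (1 + i.+1%:R^-1 `^ a)) (K / a) h1 h2.
move=> u v w u0 vw; lra.
Qed.

Lemma gamma_gt0 (a : R) : 0 < a ->
  (0 < \int[mu]_(t in `]0%R, +oo[) (t `^ (a - 1) * expR (- t))%:E)%E.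
Proof.
move=> a0; pose g (t : R) : R := t `^ (a - 1) * expR (- t).
have mg : measurable_fun setT g.
  by apply: measurable_funM; [exact: measurable_powR|exact: measurableT_comp].
have mgD (D : set (measurableTypeR R)) : measurable_fun D (EFin \o g).
  by apply: measurable_funTS; exact/measurable_EFinP.
have g0 t : 0 <= g t by rewrite mulr_ge0 ?powR_ge0 ?expR_ge0.
(* On [1, 2] one has t^(a-1) = t^a / t >= 1/2 and e^(-t) >= e^(-2). *)
apply: (@lt_le_trans _ _ (\int[mu]_(t in `[1%R, 2%R]) (expR (- 2) / 2)%:E)%E).
  rewrite integral_cst//=; rewrite lebesgue_measure_itv/= lte_fin ltr1n -EFinB -EFinM.
  by rewrite lte_fin !mulr_gt0 ?expR_gt0// subr_gt0 ltr1n.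
apply: (@le_trans _ _ (\int[mu]_(t in `[1%R, 2%R]) (g t)%:E)%E); last first.
  apply: (ge0_subset_integral mu _ _ (mgD _)) => //.
  - by move=> t _; rewrite lee_fin.
  - by move=> t /=; rewrite !in_itv/= => /andP[t1 _]; rewrite (lt_le_trans _ t1).
apply: (@ge0_le_integral _ (measurableTypeR R) R mu) => //.
move=> t; rewrite /= in_itv/= => /andP[t1 t2]; rewrite lee_fin /g mulrC.
have t0 : 0 < t by rewrite (lt_le_trans _ t1).
rewrite ler_pM ?invr_ge0 ?expR_ge0// ?ler_expR ?lerN2//.
rewrite powRB ?(gt_eqF t0) ?implybT// powRr1 ?(ltW t0)//.
rewrite ler_pdivlMr// (@le_trans _ _ 1)//; first lra.
by rewrite -(powRr0 t) ler_powR// ltW.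
Qed.

Lemma integral_gammaE (a : R) : 0 < a ->
  (\int[mu]_(t in `]0%R, +oo[) (t `^ (a - 1) * expR (- t))%:E = (Gamma a)%:E)%E.
Proof.
move=> a0; rewrite /Gamma /Rintegral fineK// ge0_fin_numE ?gamma_finite//.
by rewrite ltW// gamma_gt0.
Qed.

Lemma Gamma_gt0 (a : R) : 0 < a -> 0 < Gamma a.
Proof. by move=> a0; rewrite -lte_fin -integral_gammaE// gamma_gt0. Qed.

Lemma integral_pospowR_expR (a c : R) : 0 < a -> 0 < c ->
  (\int[mu]_t (pospowR t (a - 1) * expR (- (c * t)))%:E =
   (Gamma a * c `^ (- a))%:E)%E.
Proof.
move=> a0 c0.
pose f (t : R) : \bar R := (pospowR t (a - 1) * expR (- t))%:E.
have mf : measurable_fun setT f.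
  apply/measurable_EFinP; apply: measurable_funM; first exact: measurable_pospowR.
  exact: measurableT_comp.
have f0 t : (0 <= f t)%E by rewrite lee_fin mulr_ge0 ?pospowR_ge0 ?expR_ge0.
have ff : (\int[mu]_t f t = (Gamma a)%:E)%E.
  rewrite -integral_gammaE// [RHS]integral_mkcond; apply: eq_integral => t _.
  rewrite patchE /f /pospowR; case: ifPn => t0.
    by rewrite mem_set//= in_itv/= t0.
  by rewrite memNset ?mul0r//= in_itv/= andbT; apply/negP.
have := integral_affine 0 c0 mf f0; rewrite ff.
have -> : (fun x => f (c * x + 0)%R) =
    fun t => ((c `^ (a - 1))%:E * (pospowR t (a - 1) * expR (- (c * t)))%:E)%E.
  by apply/funext => t; rewrite addr0 /f pospowRM// -mulrA.
rewrite (ge0_integralZl_EFin _ measurableT) ?powR_ge0//; last 2 first.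
- by move=> t _; rewrite lee_fin mulr_ge0 ?pospowR_ge0 ?expR_ge0.
- apply/measurable_EFinP; apply: measurable_funM; first exact: measurable_pospowR.
  exact: measurable_expRN_scale.
set I := integral _ _ _ => cI.
have cp : 0 < c `^ (a - 1) by rewrite powR_gt0.
have -> : I = ((c `^ (a - 1))^-1%:E * ((c `^ (a - 1))%:E * I))%E.
  by rewrite muleA -EFinM mulVf ?gt_eqF// mul1e.
rewrite cI -!EFinM; congr (_%:E).
rewrite powRN powRB ?(gt_eqF c0) ?implybT// powRr1 ?(ltW c0)//.
have ca : 0 < c `^ a by rewrite powR_gt0.
by field; rewrite !gt_eqF.
Qed.

End one_variable.

(** * Integrals over the sphere of homogeneous functions *)

Lemma ge0_integral_mrestr d (T : measurableType d) (R : realType)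
    (m : {measure set T -> \bar R}) (D : set T) (mD : measurable D)
    (f : T -> \bar R) :
  measurable_fun setT f -> (forall x, (0 <= f x)%E) ->
  (\int[mrestr m mD]_x f x = \int[m]_(x in D) f x)%E.
Proof.
move=> mf f0; rewrite -(setUv D) ge0_integral_setU//; last 3 first.
- exact: measurableC.
- by rewrite setUv.
- exact/disj_setPCl.
rewrite (eq_measure_integral m); last first.
  by move=> A _ AD /=; rewrite /mrestr setIidl.
rewrite [X in (_ + X)%E](eq_measure_integral mzero) ?integral_measure_zero ?adde0//.
move=> A _ AD /=; rewrite /mrestr/= (_ : A `&` D = set0) ?measure0//.
by apply/disjoints_subset.
Qed.

Section sphere.
Context (R : realType).
Local Notation mu := (@lebesgue_measure R).

Lemma enorm_ge0 N (x : N.-tuple R) : 0 <= enorm x.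
Proof. exact: sqrtr_ge0. Qed.

Lemma enormZ N (c : R) (x y : N.-tuple R) : 0 <= c ->
  (forall i, tnth y i = c * tnth x i) -> enorm y = c * enorm x.
Proof.
move=> c0 yx; rewrite /enorm; under eq_bigr do rewrite yx exprMn.
by rewrite -mulr_sumr sqrtrM ?sqr_ge0// sqrtr_sqr ger0_norm.
Qed.

Lemma measurable_unit_sphere N : measurable (@unit_sphere R N).
Proof.
rewrite (_ : @unit_sphere R N = @enorm R N @^-1` [set 1])//.
by rewrite -[X in measurable X]setTI; exact: measurable_enorm.
Qed.

(** The sphere measure is N times the radial image of Lebesgue measure on the
    punctured ball, and the radial projection maps that ball into the sphere. *)
Lemma integral_unit_sphere N (h : N.-tuple R -> \bar R) :
  measurable_fun setT h -> (forall x, (0 <= h x)%E) ->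
  (\int[@sphere_measure R N]_(x in @unit_sphere R N) h x =
   N%:R%:E * \int[lebesgue_tuple R N]_(x in @punctured_ball R N) h (radial x))%E.
Proof.
move=> mh h0; rewrite integral_mkcond.
pose g := h \_ (@unit_sphere R N).
have mg : measurable_fun setT g.
  by apply/(measurable_restrictT _ (@measurable_unit_sphere N)); exact: measurable_funTS.
have g0 x : (0 <= g x)%E by apply: erestrict_ge0.
have N0 : (0 : R) <= N%:R by [].
pose nu := mscale (NngNum N0) (image_measure
  (mrestr (lebesgue_tuple R N) (@measurable_punctured_ball R N)) (@measurable_radial R N)).
rewrite (eq_measure_integral nu); last first.
  move=> A mA _; rewrite /nu /mscale /= /sphere_measure /pushforward /mrestr.
  by rewrite setIC.
rewrite ge0_integral_mscale// ge0_integral_image_measure// ge0_integral_mrestr//; last first.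
  by apply: measurableT_comp => //; exact: measurable_radial.
congr (_ * _)%E; apply: eq_integral => x; rewrite inE => /andP[x0 _].
rewrite /g patchE mem_set// /unit_sphere /=.
rewrite (@enormZ _ (enorm x)^-1 x) ?invr_ge0 ?ltW// => [|i].
  by rewrite mulVf ?gt_eqF.
by rewrite tnth_mktuple mulrC.
Qed.

(** By homogeneity the left side is N times the integral of |x|^N h(x) over the
    unit ball, N = p + 1, and |x|^N h(x) is constant on rays. In the coordinates
    x = s (1, t) the dilation by s contributes a Jacobian s^p, and the ball is
    s |(1, t)| <= 1. For fixed t the integral of s^p over 0 < s <= 1/|(1, t)| is
    |(1, t)|^(-N) / N, which cancels both N and |(1, t)|^N and leaves h(1, t):
    the shape of the ball drops out. *)
Lemma integral_sphere_homogeneous p (h : p.+1.-tuple R -> R) :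
  measurable_fun setT h -> (forall x, 0 <= h x) ->
  (forall x, tnth x ord0 <= 0 -> h x = 0) ->
  (forall (c : R) x y, 0 < c -> (forall i, tnth y i = c * tnth x i) ->
     h y = c ^- p.+1 * h x) ->
  (\int[@sphere_measure R p.+1]_(x in @unit_sphere R p.+1) (h x)%:E =
   \int[lebesgue_tuple R p]_t (h (tuple_cons (1, t)))%:E)%E.
Proof.
move=> mh h0 hneg hhom.
rewrite integral_unit_sphere; last 2 first.
- exact/measurable_EFinP.
- by move=> x; rewrite lee_fin.
pose F (x : p.+1.-tuple R) : R := \1_(@punctured_ball R p.+1) x * (enorm x ^+ p.+1 * h x).
have F0 x : 0 <= F x by rewrite !mulr_ge0 ?exprn_ge0 ?enorm_ge0.
have mF : measurable_fun setT F.
  apply: measurable_funM.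
    by apply/measurable_indicP; exact: (@measurable_punctured_ball R p.+1).
  apply: measurable_funM => //; apply: measurable_funX; exact: measurable_enorm.
transitivity (p.+1%:R%:E * \int[lebesgue_tuple R p.+1]_x (F x)%:E)%E.
  congr (_ * _)%E; rewrite integral_mkcond; apply: eq_integral => x _.
  rewrite patchE /F indicE; case: ifPn => [xP|]; last by rewrite mul0r.
  rewrite mul1r; congr (_%:E).
  move: xP; rewrite inE => /andP[x0 _].
  rewrite (hhom (enorm x)^-1 x) ?invr_gt0// => [|i].
    by rewrite exprVn invrK.
  by rewrite tnth_mktuple mulrC.
rewrite integral_lebesgue_tupleS; last 2 first.
- exact/measurable_EFinP.
- by move=> x; rewrite lee_fin.
pose rho (t : p.-tuple R) := enorm (tuple_cons (1, t)).
have mrho : measurable_fun setT rho.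
  by apply: measurableT_comp; [exact: measurable_enorm|exact: measurable_tuple_consr].
have rho0 t : 0 < rho t.
  rewrite /rho /enorm sqrtr_gt0 big_ord_recl tnth_cons0 expr1n.
  by rewrite ltr_wpDr// sumr_ge0// => i _; rewrite sqr_ge0.
pose w t := rho t ^+ p.+1 * h (tuple_cons (1, t)).
have w0 t : 0 <= w t by rewrite mulr_ge0 ?exprn_ge0// ltW.
have mw : measurable_fun setT w.
  apply: measurable_funM; first exact: measurable_funX.
  by apply: measurableT_comp => //; exact: measurable_tuple_consr.
pose A : set (measurableTypeR R * p.-tuple R) :=
  [set z | 0 < z.1 /\ z.1 * rho z.2 <= 1].
have mA : measurable A.
  have -> : A = (fst @^-1` `]0, +oo[) `&` ((fun z => z.1 * rho z.2) @^-1` `]-oo, 1]).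
    by apply/seteqP; split => -[x t] /=; rewrite /A /= !in_itv/= andbT.
  apply: measurableI.
    by rewrite -[X in measurable X]setTI; exact: measurable_fst.
  rewrite -[X in measurable X]setTI.
  have mz : measurable_fun setT (fun z : measurableTypeR R * p.-tuple R => z.1 * rho z.2).
    apply: measurable_funM; first exact: measurable_fst.
    by apply: measurableT_comp => //; exact: measurable_snd.
  exact: mz.
(* |x|^N h(x) s^p on the ball in the coordinates x = s (1, t). *)
pose K (z : measurableTypeR R * p.-tuple R) : R := \1_A z * (z.1 ^+ p * w z.2).
have K0 z : 0 <= K z.
  rewrite /K indicE; have [|_] := boolP (z \in A); last by rewrite mul0r.
  by rewrite inE => -[/= z0 _]; rewrite mul1r mulr_ge0// exprn_ge0// ltW.
have mK : measurable_fun setT K.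
  apply: measurable_funM; first exact/measurable_indicP.
  apply: measurable_funM.
    by apply: measurable_funX; exact: measurable_fst.
  by apply: measurableT_comp => //; exact: measurable_snd.
transitivity (p.+1%:R%:E * \int[mu]_x \int[lebesgue_tuple R p]_t (K (x, t))%:E)%E.
  apply: (congr1 (fun z => p.+1%:R%:E * z)%E); apply: eq_integral => x _.
  have [x0|x0] := leP x 0.
    apply: eq_integral => t _; rewrite /F hneg ?tnth_cons0// !mulr0.
    by rewrite /K indicE memNset ?mul0r// => -[/=]; rewrite ltNge x0.
  pose f (t : p.-tuple R) : \bar R := (x ^+ p * F (tuple_cons (x, t)))%:E.
  have mf : measurable_fun setT f.
    apply/measurable_EFinP; apply: measurable_funM => //.
    by apply: measurableT_comp => //; exact: measurable_tuple_consr.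
  have f0 t : (0 <= f t)%E by rewrite lee_fin mulr_ge0 ?exprn_ge0 ?(ltW x0).
  have xp : 0 < x ^+ p by rewrite exprn_gt0.
  transitivity ((x ^- p)%:E * \int[lebesgue_tuple R p]_t f t)%E.
    rewrite -(ge0_integralZl_EFin _ measurableT) ?invr_ge0 ?(ltW xp)//.
    by apply: eq_integral => t _; rewrite -EFinM mulKf ?gt_eqF.
  (* The slice at height x is the dilation by x of the slice at height 1. *)
  rewrite -(integral_affine_tuple [tuple 0 | i < p] x0 mf f0).
  apply: eq_integral => t _; rewrite /f /K /F /=; congr (_%:E).
  set y := tuple_cons _.
  have yt i : tnth y i = x * tnth (tuple_cons (1, t)) i.
    case: (unliftP ord0 i) => [j|] ->; last by rewrite !tnth_cons0 mulr1.
    by rewrite !tnth_consS !tnth_mktuple addr0.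
  rewrite mulrCA; congr (_ * _).
    rewrite !indicE; congr ((nat_of_bool _)%:R); apply/idP/idP; rewrite !inE.
      by move=> /andP[_]; rewrite (enormZ (ltW x0) yt).
    move=> [/= _ xr]; rewrite /punctured_ball /= (enormZ (ltW x0) yt).
    by rewrite mulr_gt0// rho0.
  rewrite (enormZ (ltW x0) yt) (hhom x _ _ x0 yt) exprMn /w; congr (_ * _).
  by rewrite -/(rho t); field; rewrite expf_neq0// gt_eqF.
have mEK : measurable_fun setT (EFin \o K) by exact/measurable_EFinP.
have EK0 z : (0 <= (EFin \o K) z)%E by rewrite lee_fin.
rewrite (fubini_tonelli (m1 := mu) (m2 := lebesgue_tuple R p) _ mEK EK0) /=.
have inner t : (\int[mu]_x (K (x, t))%:E = (h (tuple_cons (1, t)) / p.+1%:R)%:E)%E.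
  have r0 : 0 < (rho t)^-1 by rewrite invr_gt0.
  transitivity ((w t)%:E * \int[mu]_(x in `]0%R, (rho t)^-1%R]) (x ^+ p)%:E)%E.
    rewrite -ge0_integralZl_EFin//; last 2 first.
    - move=> x; rewrite /= in_itv/= => /andP[x0 _].
      by rewrite lee_fin exprn_ge0// ltW.
    - by apply/measurable_EFinP; exact: measurable_funX.
    rewrite [RHS]integral_mkcond; apply: eq_integral => x _.
    rewrite patchE /K indicE /=.
    have -> : ((x, t) \in A) = (x \in `]0%R, (rho t)^-1]%classic).
      apply/idP/idP; rewrite !inE /A /= in_itv/= -[_^-1]div1r ler_pdivlMr//.
        by move=> [-> ->].
      by move=> /andP[].
    by case: ifPn => _; rewrite ?mul0r// mul1r -EFinM mulrC.
  rewrite integral_expr// -EFinM /w; congr (_%:E).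
  rewrite exprVn; field; rewrite expf_neq0 ?gt_eqF//.
under eq_integral do rewrite inner.
rewrite -ge0_integralZl_EFin//; last 2 first.
- by move=> t _; rewrite lee_fin divr_ge0.
- apply/measurable_EFinP; apply: measurable_funM => //.
  by apply: measurableT_comp => //; exact: measurable_tuple_consr.
by apply: eq_integral => t _; rewrite -EFinM mulrC divfK.
Qed.

End sphere.

(** * The fibre integral and its Laplace transform *)

Section fibre_integral.
Context (R : realType) (p n : nat).
Variables (Y : 'M[R]_(p, n)) (a : 'I_p -> R) (b : 'I_n -> R).
Hypotheses (a0 : forall i, 0 < a i) (b0 : forall k, 0 < b k).
Local Notation mu := (@lebesgue_measure R).
Implicit Types (y : n.-tuple R) (t : p.-tuple R).

Definition row_comb t : n.-tuple R := [tuple \sum_i tnth t i * Y i k | k < n].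

Definition fibre_integrand y t : R :=
  (\prod_i pospowR (tnth t i) (a i - 1)) *
  \prod_k pospowR (tnth y k - tnth (row_comb t) k) (b k - 1).

(** Nonnegative weights t for which y - tY has nonnegative coordinates
    parametrize the fibre over y of the map from the orthant onto the dual cone
    that sends (t, s) to the point with coordinates s + tY. Integrating the
    monomial density along the fibre gives the density of its image. *)
Definition fibre_integral y : \bar R :=
  (\int[lebesgue_tuple R p]_t (fibre_integrand y t)%:E)%E.

Lemma fibre_integrand_ge0 y t : 0 <= fibre_integrand y t.
Proof. by rewrite mulr_ge0// prodr_ge0// => i _; exact: pospowR_ge0. Qed.

Lemma fibre_integral_ge0 y : (0 <= fibre_integral y)%E.
Proof. by apply: integral_ge0 => t _; rewrite lee_fin fibre_integrand_ge0. Qed.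

Lemma measurable_row_comb k : measurable_fun setT (fun t => tnth (row_comb t) k).
Proof.
rewrite (_ : (fun t => _) = fun t => \sum_i tnth t i * Y i k); last first.
  by apply/funext => t; rewrite tnth_mktuple.
apply: measurable_sum => i; apply: measurable_funM => //.
exact: measurable_tnth.
Qed.

Lemma measurable_fibre_integrand :
  measurable_fun setT (fun z : n.-tuple R * p.-tuple R => fibre_integrand z.1 z.2).
Proof.
apply: measurable_funM; apply: measurable_prod => k _.
  apply: (measurableT_comp (measurable_pospowR _)).
  exact: (measurableT_comp (measurable_tnth k)).
apply: (measurableT_comp (measurable_pospowR _)).
apply: measurable_funB.
  exact: (measurableT_comp (measurable_tnth k)).
exact: (measurableT_comp (measurable_row_comb k)).
Qed.

Lemma measurable_fibre_integral : measurable_fun setT fibre_integral.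
Proof.
apply: (measurable_fun_fubini_tonelli_F (m2 := lebesgue_tuple R p)
  (fun z : n.-tuple R * p.-tuple R => (fibre_integrand z.1 z.2)%:E)).
  by apply/measurable_EFinP; exact: measurable_fibre_integrand.
by move=> z; rewrite lee_fin fibre_integrand_ge0.
Qed.

Lemma measurable_expRN_dot q (u : 'I_q -> R) :
  measurable_fun setT (fun y : q.-tuple R => expR (- \sum_k tnth y k * u k)).
Proof.
apply: measurableT_comp => //; apply: measurableT_comp => //.
apply: measurable_sum => k; apply: measurable_funM => //.
exact: measurable_tnth.
Qed.

Lemma integral_prod_pospowR_expR q (c u : 'I_q -> R) :
  (forall k, 0 < c k) -> (forall k, 0 < u k) ->
  (\int[lebesgue_tuple R q]_s
     (expR (- \sum_k tnth s k * u k) * \prod_k pospowR (tnth s k) (c k - 1))%:E =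
   (\prod_k (Gamma (c k) * u k `^ (- c k)))%:E)%E.
Proof.
move=> c0 u0.
rewrite -(@integral_prod_tnth _ _ (fun k x => pospowR x (c k - 1) * expR (- (u k * x))));
  last 3 first.
- by move=> k; apply: measurable_funM; [exact: measurable_pospowR|exact: measurable_expRN_scale].
- by move=> k x; rewrite mulr_ge0 ?pospowR_ge0 ?expR_ge0.
- by move=> k; exact: integral_pospowR_expR.
apply: eq_integral => s _; rewrite -sumrN expR_sum -big_split/=.
by congr (_%:E); apply: eq_bigr => k _; rewrite mulrC (mulrC (u k)).
Qed.

(** After Tonelli, the translation s = y - tY turns the exponent into
    <s, u> + <t, v>, and the integral becomes a product of Gamma integrals, one
    for each form. *)
Lemma laplace_fibre_integral (u : 'I_n -> R) (v : 'I_p -> R) :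
  (forall k, 0 < u k) -> (forall i, 0 < v i) ->
  (forall i, v i = \sum_k Y i k * u k) ->
  (\int[lebesgue_tuple R n]_y
     ((expR (- \sum_k tnth y k * u k))%:E * fibre_integral y) =
   ((\prod_i (Gamma (a i) * v i `^ (- a i))) *
    (\prod_k (Gamma (b k) * u k `^ (- b k))))%:E)%E.
Proof.
move=> u0 v0 vE.
pose e y : R := expR (- \sum_k tnth y k * u k).
pose Pt t : R := \prod_i pospowR (tnth t i) (a i - 1).
pose Qs y : R := \prod_k pospowR (tnth y k) (b k - 1).
have Pt0 t : 0 <= Pt t by rewrite prodr_ge0// => i _; exact: pospowR_ge0.
have Qs0 y : 0 <= Qs y by rewrite prodr_ge0// => i _; exact: pospowR_ge0.
pose g (z : n.-tuple R * p.-tuple R) : \bar R := (e z.1 * fibre_integrand z.1 z.2)%:E.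
have mg : measurable_fun setT g.
  apply/measurable_EFinP; apply: measurable_funM; last exact: measurable_fibre_integrand.
  exact: (measurableT_comp (measurable_expRN_dot u)).
have g0 z : (0 <= g z)%E by rewrite lee_fin mulr_ge0 ?expR_ge0 ?fibre_integrand_ge0.
transitivity (\int[lebesgue_tuple R n]_y \int[lebesgue_tuple R p]_t g (y, t))%E.
  apply: eq_integral => y _.
  rewrite -ge0_integralZl_EFin ?expR_ge0//.
  - by move=> t _; rewrite lee_fin fibre_integrand_ge0.
  - apply/measurable_EFinP.
    exact: (measurableT_comp measurable_fibre_integrand (measurable_pair1 y)).
rewrite (fubini_tonelli (m1 := lebesgue_tuple R n) (m2 := lebesgue_tuple R p) _ mg g0).
pose c := \prod_k (Gamma (b k) * u k `^ (- b k)).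
have cE : (\int[lebesgue_tuple R n]_s (e s * Qs s)%:E = c%:E)%E.
  exact: integral_prod_pospowR_expR.
have c0 : 0 <= c.
  by rewrite prodr_ge0// => k _; rewrite mulr_ge0 ?powR_ge0 ?ltW ?Gamma_gt0.
pose ev t : R := expR (- \sum_i tnth t i * v i).
transitivity (\int[lebesgue_tuple R p]_t (c%:E * (ev t * Pt t)%:E))%E.
  apply: eq_integral => t _.
  have mgt : measurable_fun setT (fun y => g (y, t)).
    exact: (measurableT_comp mg (measurable_pair2 t)).
  have := integral_affine_tuple (row_comb t) ltr01 mgt (fun y => g0 _).
  rewrite expr1n invr1 mul1e => <-.
  have k0 : 0 <= ev t * Pt t by rewrite mulr_ge0 ?expR_ge0.
  have es0 s : (0 <= (e s * Qs s)%:E)%E by rewrite lee_fin mulr_ge0 ?expR_ge0.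
  have mes : measurable_fun setT (fun s => (e s * Qs s)%:E).
    apply/measurable_EFinP; apply: measurable_funM; first exact: measurable_expRN_dot.
    exact: (measurable_prod_tnth (fun k => measurable_pospowR (b k - 1))).
  rewrite muleC -cE -(ge0_integralZl_EFin _ measurableT (fun s _ => es0 s) mes k0).
  apply: eq_integral => s _; rewrite /g /fibre_integrand -EFinM; congr (_%:E) => /=.
  rewrite -/(Pt t) (_ : \prod_k _ = Qs s); last first.
    by apply: eq_bigr => k _; rewrite tnth_mktuple mul1r addrK.
  rewrite (_ : e _ = e s * ev t); first by ring.
  rewrite /e /ev -expRD -opprD; congr (expR (- _)).
  under eq_bigr do rewrite tnth_mktuple mul1r mulrDl.
  rewrite big_split/=; congr (_ + _).
  under eq_bigr do rewrite tnth_mktuple mulr_suml.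
  rewrite exchange_big/=; apply: eq_bigr => i _.
  by rewrite vE mulr_sumr; apply: eq_bigr => k _; rewrite mulrA.
have ev0 t : (0 <= (ev t * Pt t)%:E)%E by rewrite lee_fin mulr_ge0 ?expR_ge0.
have mev : measurable_fun setT (fun t => (ev t * Pt t)%:E).
  apply/measurable_EFinP; apply: measurable_funM; first exact: measurable_expRN_dot.
  exact: (measurable_prod_tnth (fun i => measurable_pospowR (a i - 1))).
rewrite (ge0_integralZl_EFin _ measurableT (fun t _ => ev0 t) mev c0).
by rewrite integral_prod_pospowR_expR// -EFinM mulrC.
Qed.

End fibre_integral.

(** * The Aomoto-Gel'fand integral at real parameters *)

Section real_parameters.
Context (R : realType).

Lemma pospow_real (t s : R) : pospow t ((s%:C) - 1) = (pospowR t (s - 1))%:C.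
Proof.
have -> : s%:C - 1 = (s - 1)%:C by rewrite rmorphB rmorph1.
rewrite /pospow /pospowR; case: ifP => // _.
by rewrite /= mul0r cos0 sin0 -[Complex 1 0]/(1%:C) rmorph1 mulr1.
Qed.

(** A real integrand with finite integral converges in the sense of
    [AG_converges], so no analytic continuation enters the value of [AG]. *)
Lemma AG_eq_real_integral N K (A : 'M[R]_(N, N + K)) (c : 'rV[R[i]]_(N + K))
    (h : N.-tuple R -> R) (r : R) :
  (forall x, AG_integrand A c x = (h x)%:C) ->
  measurable_fun setT h -> (forall x, 0 <= h x) ->
  (\int[@sphere_measure R N]_(x in @unit_sphere R N) (h x)%:E = r%:E)%E ->
  AG A c = r%:C.
Proof.
move=> Ah mh h0 hr.
have ReA x : complex.Re (AG_integrand A c x) = h x by rewrite Ah.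
have ImA x : complex.Im (AG_integrand A c x) = 0 by rewrite Ah.
rewrite /AG asboolT; last first.
  split.
    apply/integrableP; split.
      under eq_fun do rewrite ReA.
      by apply/measurable_EFinP; exact: measurable_funTS.
    under eq_integral do rewrite ReA gee0_abs ?lee_fin//.
    by rewrite hr ltry.
  under eq_fun do rewrite ImA.
  exact: integrable0.
rewrite /AG_integral /Rintegral.
under eq_integral do rewrite ReA.
under [X in Complex _ (fine X)]eq_integral do rewrite ImA.
by rewrite hr integral0.
Qed.

Variables (p n : nat) (Y : 'M[R]_(p, n)).
Variables (a0 : R) (a : 'I_p -> R) (b : 'I_n -> R).
Implicit Types (y : n.-tuple R) (x : p.+1.-tuple R).

(** Half of the sphere, x_0 <= 0, carries no mass because of the first factor,
    whatever the sign of [a0] - 1; the chart x_0 = 1 sees everything else. *)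
Definition AG_real_integrand y x : R :=
  pospowR (tnth x ord0) (a0 - 1) *
  \prod_(i < p) pospowR (tnth x (lift ord0 i)) (a i - 1) *
  \prod_(k < n) pospowR (tnth y k * tnth x ord0
    - \sum_(i < p) tnth x (lift ord0 i) * Y i k) (b k - 1).

Lemma AG_real_integrand_ge0 y x : 0 <= AG_real_integrand y x.
Proof.
by rewrite !mulr_ge0 ?pospowR_ge0// prodr_ge0// => k _; exact: pospowR_ge0.
Qed.

Lemma measurable_AG_real_integrand y : measurable_fun setT (AG_real_integrand y).
Proof.
apply: measurable_funM; last first.
  apply: measurable_prod => k _; apply: (measurableT_comp (measurable_pospowR _)).
  apply: measurable_funB.
    by apply: measurable_funM => //; exact: measurable_tnth.
  by apply: measurable_sum => i; apply: measurable_funM => //; exact: measurable_tnth.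
apply: measurable_funM.
  exact: (measurableT_comp (measurable_pospowR _) (measurable_tnth _)).
apply: measurable_prod => i _.
exact: (measurableT_comp (measurable_pospowR _) (measurable_tnth _)).
Qed.

(** Each factor is homogeneous of degree its parameter minus 1; the parameters
    add up to n and there are p + 1 + n factors, so the degree is -(p + 1). *)
Lemma AG_real_integrand_homogeneous y (c : R) x x' :
  a0 + \sum_i a i + \sum_k b k = n%:R -> 0 < c ->
  (forall i, tnth x' i = c * tnth x i) ->
  AG_real_integrand y x' = c ^- p.+1 * AG_real_integrand y x.
Proof.
move=> sum_ab c0 xc; rewrite /AG_real_integrand xc pospowRM//.
under eq_bigr do rewrite xc pospowRM//.
rewrite big_split/=.
under [X in _ * X = _]eq_bigr => k _.
  under eq_bigr do rewrite xc -mulrA.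
  rewrite -mulr_sumr mulrCA -mulrBr pospowRM//.
  over.
rewrite big_split/=.
have cE q (s : 'I_q -> R) : \prod_k c `^ s k = c `^ (\sum_k s k).
  elim/big_rec2: _ => [|k u v _ ->]; first by rewrite powRr0.
  by rewrite powRD// (gt_eqF c0) implybT.
rewrite !cE.
have -> : c ^- p.+1 = c `^ (a0 - 1) * c `^ (\sum_i (a i - 1)) * c `^ (\sum_k (b k - 1)).
  rewrite -!powRD ?(gt_eqF c0) ?implybT// -powR_invn ?ltW//; congr (_ `^ _).
  rewrite !sumrB !sumr_const !card_ord -natr1; lra.
by ring.
Qed.

Lemma AG_real_integrand_chart y t :
  AG_real_integrand y (tuple_cons (1, t)) = fibre_integrand Y a b y t.
Proof.
rewrite /AG_real_integrand tnth_cons0 /pospowR ltr01 powR1 mul1r.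
rewrite /fibre_integrand; congr (_ * _).
  by apply: eq_bigr => i _; rewrite tnth_consS.
apply: eq_bigr => k _; rewrite mulr1 tnth_mktuple.
by congr (pospowR (_ - _) _); apply: eq_bigr => i _; rewrite tnth_consS.
Qed.

Lemma integral_AG_real_integrand y : a0 + \sum_i a i + \sum_k b k = n%:R ->
  (\int[@sphere_measure R p.+1]_(x in @unit_sphere R p.+1) (AG_real_integrand y x)%:E =
   fibre_integral Y a b y)%E.
Proof.
move=> sum_ab; rewrite integral_sphere_homogeneous.
- by apply: eq_integral => t _; rewrite AG_real_integrand_chart.
- exact: measurable_AG_real_integrand.
- exact: AG_real_integrand_ge0.
- by move=> x x0; rewrite /AG_real_integrand {1}/pospowR ltNge x0 !mul0r.
- by move=> c x x'; exact: AG_real_integrand_homogeneous.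
Qed.

(** The entries of [A] and [c] enter through hypotheses, so that no particular
    block presentation of the matrix is imposed. *)
Lemma AG_fibre_integral (A : 'M[R]_(p.+1, p.+1 + n)) (c : 'rV[R[i]]_(p.+1 + n)) y :
  a0 + \sum_i a i + \sum_k b k = n%:R ->
  c 0 (lshift n ord0) = a0%:C ->
  (forall i, c 0 (lshift n (lift ord0 i)) = (a i)%:C) ->
  (forall k, c 0 (rshift p.+1 k) = (b k)%:C) ->
  (forall k, A ord0 (rshift p.+1 k) = tnth y k) ->
  (forall i k, A (lift ord0 i) (rshift p.+1 k) = - Y i k) ->
  fibre_integral Y a b y \is a fin_num ->
  AG A c = (fine (fibre_integral Y a b y))%:C.
Proof.
move=> sum_ab c0 ca cb A0 A1 fin.
apply: (@AG_eq_real_integral _ _ _ _ (AG_real_integrand y)); last first.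
- by rewrite fineK// integral_AG_real_integrand.
- exact: AG_real_integrand_ge0.
- exact: measurable_AG_real_integrand.
move=> x; rewrite /AG_integrand /AG_real_integrand big_ord_recl c0 pospow_real.
under eq_bigr do rewrite ca pospow_real.
under [X in _ * X = _]eq_bigr => k _.
  rewrite cb pospow_real big_ord_recl A0.
  under eq_bigr do rewrite A1 mulNr mulrC.
  rewrite sumrN.
  over.
by rewrite -!rmorph_prod -!rmorphM.
Qed.

End real_parameters.

(** * The Riesz kernel *)

Section cone.
Context (R : realType) (n p : nat).
Variables (l : 'I_(p + n) -> 'Hom('rV[R]_n, R^o)) (B : n.-tuple 'Hom('rV[R]_n, R^o)).
Hypotheses (hB : forall k : 'I_n, tnth B k = l (rshift p k)) (hbasis : basis_of fullv B).

Definition form_coords : 'M[R]_(p, n) :=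
  \matrix_(i < p, k < n) coord B k (l (lshift n i)).

Lemma form_coordsE i : l (lshift n i) = \sum_k form_coords i k *: tnth B k.
Proof.
rewrite [LHS](coord_basis hbasis (memvf _)); apply: eq_bigr => k _.
by rewrite mxE (tnth_nth 0).
Qed.

Lemma form_coords_eval i x :
  l (lshift n i) x = \sum_k form_coords i k * l (rshift p k) x.
Proof.
rewrite form_coordsE sum_lfunE; apply: eq_bigr => k _.
by rewrite scale_lfunE hB.
Qed.

Lemma of_coords_eval (y : n.-tuple R) x :
  of_coords B y x = \sum_k tnth y k * l (rshift p k) x.
Proof.
by rewrite sum_lfunE; apply: eq_bigr => k _; rewrite scale_lfunE hB.
Qed.

(** A weight t with nonzero integrand writes y as the positive combination of
    the forms with coefficients t and y - tY. Thus integrals of the kernel over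
    the dual cone are integrals over the whole space. *)
Lemma fibre_integral_off_cone (a : 'I_p -> R) (b : 'I_n -> R) (y : n.-tuple R) :
  ~ dual_cone l (of_coords B y) -> fibre_integral form_coords a b y = 0%E.
Proof.
move=> yD; rewrite /fibre_integral integral0_eq// => t _; congr (_%:E).
have [//|/eqP] := eqVneq (fibre_integrand form_coords a b y t) 0.
move=> /eqP; rewrite mulf_eq0 negb_or => /andP[tn0 sn0].
have pospow_gt0 (u s : R) : pospowR u s != 0 -> 0 < u.
  by rewrite /pospowR; case: ifP => //; rewrite eqxx.
pose s k := tnth y k - tnth (row_comb form_coords t) k.
have t0 i : 0 < tnth t i by move/prodf_neq0: tn0 => /(_ i isT) /pospow_gt0.
have s0 k : 0 < s k by move/prodf_neq0: sn0 => /(_ k isT) /pospow_gt0.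
exfalso; apply: yD.
exists (fun j => row_mx (\row_i tnth t i) (\row_k s k) 0 j) => [j|].
  by rewrite mxE; case: splitP => k _; rewrite mxE ltW.
rewrite big_split_ord/= /of_coords.
under eq_bigr do rewrite row_mxEl mxE form_coordsE scaler_sumr.
under [X in _ = _ + X]eq_bigr do rewrite row_mxEr mxE -hB.
rewrite exchange_big/= -big_split/=; apply: eq_bigr => k _.
under eq_bigr do rewrite scalerA.
rewrite -scaler_suml -scalerDl; congr (_ *: _).
by rewrite /s tnth_mktuple addrC subrK.
Qed.

End cone.

Theorem theorem7p4 (R : realType) (n p : nat) (hn : (1 <= n)%N)
    (l : 'I_(p + n) -> 'Hom('rV[R]_n, R^o))
    (hC : open_cone l !=set0)
    (hfull : full_dim_cone (dual_cone l))
    (hpointed : pointed_cone (dual_cone l))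
    (B : n.-tuple 'Hom('rV[R]_n, R^o))
    (hB : forall k : 'I_n, tnth B k = l (rshift p k))
    (hbasis : basis_of fullv B)
    (alpha : 'I_(p + n).+1 -> R)
    (halpha : forall i : 'I_(p + n), 0 < alpha (lift ord0 i))
    (halpha0 : \sum_(i < (p + n).+1) alpha i = n%:R) :
  exists q : n.-tuple R -> R,
    riesz_kernel l B
      (fun x => \prod_(i < p + n) l i x `^ (- alpha (lift ord0 i))) q /\
    {ae lebesgue_tuple R n, forall y : n.-tuple R,
      dual_cone l (of_coords B y) ->
      (q y)%:C =
        AG (row_mx 1%:M
              (col_mx (\row_(k < n) tnth y k)
                      (- \matrix_(i < p, k < n) coord B k (l (lshift n i)))))
           (\row_(j < (p + n).+1) (alpha j)%:C)
        / (\prod_(i < p + n) Gamma (alpha (lift ord0 i)))%:C}.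
Proof.
pose a (i : 'I_p) := alpha (lift ord0 (lshift n i)).
pose b (k : 'I_n) := alpha (lift ord0 (rshift p k)).
pose Y := form_coords l B.
pose I := fibre_integral Y a b.
have a0 i : 0 < a i by exact: halpha.
have b0 k : 0 < b k by exact: halpha.
have sum_ab : alpha ord0 + \sum_i a i + \sum_k b k = n%:R.
  by rewrite -halpha0 big_ord_recl big_split_ord addrA.
pose G := \prod_(i < p + n) Gamma (alpha (lift ord0 i)).
have G0 : 0 < G by apply: prodr_gt0 => i _; exact: Gamma_gt0.
have mI : measurable_fun setT I by exact: measurable_fibre_integral.
have I0 y : (0 <= I y)%E by exact: fibre_integral_ge0.
pose e x (y : n.-tuple R) : R := expR (- of_coords B y x).
have eE x : e x = fun y => expR (- \sum_k tnth y k * l (rshift p k) x).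
  by apply/funext => y; rewrite /e (of_coords_eval hB).
have me x : measurable_fun setT (e x).
  by rewrite eE; exact: measurable_expRN_dot.
have laplace x : open_cone l x ->
    (\int[lebesgue_tuple R n]_y ((e x y)%:E * I y) =
     (G * \prod_(i < p + n) l i x `^ (- alpha (lift ord0 i)))%:E)%E.
  move=> Cx.
  under eq_integral do rewrite eE.
  rewrite (@laplace_fibre_integral _ _ _ Y a b a0 b0
    (fun k => l (rshift p k) x) (fun i => l (lshift n i) x))//; last first.
    by move=> i; exact: form_coords_eval.
  by congr (_%:E); rewrite /G -big_split/= big_split_ord.
(* The Laplace transform is finite at a point of the cone, so the fibre integral
   is finite almost everywhere; it may be infinite on a null set, where [q] takes
   the default value 0. *)
have Ifin : {ae lebesgue_tuple R n, forall y, I y \is a fin_num}.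
  have [x Cx] := hC.
  have eI : (lebesgue_tuple R n).-integrable setT (fun y => (e x y)%:E * I y)%E.
    apply/integrableP; split.
      by apply: emeasurable_funM => //; exact/measurable_EFinP.
    under eq_integral do rewrite gee0_abs ?mule_ge0 ?lee_fin ?expR_ge0//.
    by rewrite laplace// ltry.
  apply: filterS (integrable_ae measurableT eI) => y /(_ Logic.I).
  rewrite !ge0_fin_numE ?mule_ge0 ?lee_fin ?expR_ge0//.
  case: (I y) (I0 y) => [r| |]// _; first by rewrite !ltry.
  by rewrite gt0_muley// lte_fin expR_gt0.
pose q y := fine (I y) / G.
have q0 y : 0 <= q y by rewrite divr_ge0 ?fine_ge0// ltW.
have mq : measurable_fun setT q.
  by apply: measurable_funM => //; exact: measurableT_comp.
exists q; split.
  split.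
  - exact: measurable_funTS.
  - by [].
  - move=> x Cx.
    rewrite integral_mkcond.
    transitivity (\int[lebesgue_tuple R n]_y ((e x y * q y)%:E))%E; last first.
      apply: eq_integral => y _; rewrite patchE; case: ifPn => //.
      move=> /negP yD; rewrite /q /I fibre_integral_off_cone ?mul0r ?mulr0//.
      by move=> h; apply: yD; rewrite inE.
    transitivity ((G^-1)%:E * \int[lebesgue_tuple R n]_y ((e x y)%:E * I y))%E.
      by rewrite laplace// -EFinM mulKf// gt_eqF.
    have meI : measurable_fun setT (fun y => (e x y)%:E * I y)%E.
      by apply: emeasurable_funM => //; exact/measurable_EFinP.
    have eI0 y : (0 <= (e x y)%:E * I y)%E by rewrite mule_ge0 ?lee_fin ?expR_ge0.
    have Gi : 0 <= G^-1 by rewrite invr_ge0 ltW.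
    rewrite -(ge0_integralZl_EFin _ measurableT (fun y _ => eI0 y) meI Gi).
    apply: ge0_ae_eq_integral => //.
    + exact: emeasurable_funM.
    + by apply/measurable_EFinP; exact: measurable_funM.
    + by move=> y _; rewrite mule_ge0// lee_fin.
    + by move=> y _; rewrite lee_fin mulr_ge0 ?expR_ge0.
    apply: filterS Ifin => y yfin _.
    rewrite -(fineK yfin) -!EFinM /q; congr (_%:E).
    by rewrite mulrC -mulrA.
apply: filterS Ifin => y yfin _.
have hAG := @AG_fibre_integral R p n Y (alpha ord0) a b
  (row_mx 1%:M (col_mx (\row_(k < n) tnth y k) (- Y)))
  (\row_(j < (p + n).+1) (alpha j)%:C) y sum_ab _ _ _ _ _ yfin.
rewrite -/Y hAG.
- by rewrite -fmorphV -rmorphM.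
- by rewrite mxE; congr (alpha _)%:C; apply/val_inj.
- by move=> i; rewrite mxE; congr (alpha _)%:C; apply/val_inj.
- by move=> k; rewrite mxE; congr (alpha _)%:C; apply/val_inj.
- move=> k; rewrite row_mxEr (_ : @ord0 p = lshift p (@ord0 0)); last exact/val_inj.
  by apply: (etrans (col_mxEu (\row_(j < n) tnth y j) (- Y) ord0 k)); rewrite mxE.
- move=> i k; rewrite row_mxEr (_ : lift (@ord0 p) i = rshift 1 i); last exact/val_inj.
  by apply: (etrans (col_mxEd (\row_(j < n) tnth y j) (- Y) i k)); rewrite mxE.
Qed.
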